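(* Let $\mathcal{L}$ be a super-intuitionistic (second-order propositional) logic and suppose there is a formula $t(P)$ in one variable such that for every formula $P$, $$\neg\neg P,\ P\rightarrow(t(P)\vee\neg t(P))\vdash_{\mathcal{L}}P.$$ Then $\neg\neg P\vdash_{\mathcal{L}}P$ for any formula $P$.
   Context: Formulas of second-order intuitionistic propositional logic are built from countably many propositional variables and $\bot$ using $\wedge,\vee,\rightarrow$ and the propositional quantifiers $\forall X,\exists X$; $\neg A$ abbreviates $A\rightarrow\bot$; $t(P)$ for a formula $P$ is the (capture-avoiding) substitution of $P$ for the variable of $t$. An empty right-hand side of a sequent stands for $\bot$; left-hand sides are finite sequences of formulas up to order. A super-intuitionistic logic $\mathcal{L}$ is a binary relation $\vdash_{\mathcal{L}}$ between finite sequences of formulas (left) and single formulas (right) closed under all inference rules of the standard Gentzen-style intuitionistic sequent calculus: axiom $\varphi\vdash\varphi$; cut; left weakening, left contraction, right weakening; the usual left and right rules for $\wedge,\vee,\rightarrow$; $\bot\vdash\varphi$; $\forall L$: from $\Gamma,\varphi[T/X]\vdash\psi$ infer $\Gamma,\forall X.\varphi\vdash\psi$; $\forall R$: from $\Gamma\vdash\varphi$ infer $\Gamma\vdash\forall X.\varphi$ ($X$ not free in $\Gamma$); $\exists R$: from $\Gamma\vdash\varphi[T/X]$ infer $\Gamma\vdash\exists X.\varphi$; $\exists L$: from $\Gamma,\varphi\vdash\psi$ infer $\Gamma,\exists X.\varphi\vdash\psi$ ($X$ not free in $\Gamma,\psi$), with $T$ an arbitrary formula. *)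

(* Defs.v *)
From Stdlib Require Import List Permutation PeanoNat.
Import ListNotations.

(** Formulas are taken up to renaming of bound variables, by way of de Bruijn
    indices: under [k] nested [AllDB]/[ExDB], the index [i < k] refers to a
    binder and the index [k + n] to the propositional variable number [n].
    The named quantifiers of the object language are [All X A] and [Ex X A]
    below. *)
Inductive form : Type :=
| Var (n : nat)
| Bot
| And (A B : form)
| Or (A B : form)
| Imp (A B : form)
| AllDB (A : form)
| ExDB (A : form).

Definition Neg (A : form) : form := Imp A Bot.

Fixpoint free (X : nat) (A : form) : Prop :=
  match A with
  | Var n => n = X
  | Bot => False
  | And A B | Or A B | Imp A B => free X A \/ free X B
  | AllDB A | ExDB A => free (S X) A
  end.

Definition up_ren (r : nat -> nat) (n : nat) : nat :=
  match n with 0 => 0 | S m => S (r m) end.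

Fixpoint rename (r : nat -> nat) (A : form) : form :=
  match A with
  | Var n => Var (r n)
  | Bot => Bot
  | And A B => And (rename r A) (rename r B)
  | Or A B => Or (rename r A) (rename r B)
  | Imp A B => Imp (rename r A) (rename r B)
  | AllDB A => AllDB (rename (up_ren r) A)
  | ExDB A => ExDB (rename (up_ren r) A)
  end.

Definition up (s : nat -> form) (n : nat) : form :=
  match n with 0 => Var 0 | S m => rename S (s m) end.

Fixpoint inst (s : nat -> form) (A : form) : form :=
  match A with
  | Var n => s n
  | Bot => Bot
  | And A B => And (inst s A) (inst s B)
  | Or A B => Or (inst s A) (inst s B)
  | Imp A B => Imp (inst s A) (inst s B)
  | AllDB A => AllDB (inst (up s) A)
  | ExDB A => ExDB (inst (up s) A)
  end.

(** [A[T/X]]; the other variables are left alone (no index is lowered). *)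
Definition subst (X : nat) (T A : form) : form :=
  inst (fun n => if n =? X then T else Var n) A.

(** Turns the variable [X] into index 0, as the body of a new binder. *)
Definition bind (X : nat) (A : form) : form :=
  rename (fun n => if n =? X then 0 else S n) A.

Definition All (X : nat) (A : form) : form := AllDB (bind X A).
Definition Ex (X : nat) (A : form) : form := ExDB (bind X A).

(** Left-hand sides are lists, made insensitive to order by [si_exchange];
    an empty right-hand side is [Bot], whence the form of [si_weakR]. *)
Record superintuitionistic (L : list form -> form -> Prop) : Prop := {
  si_exchange : forall G D A, Permutation G D -> L G A -> L D A;
  si_ax : forall A, L [A] A;
  si_cut : forall G D A B, L G A -> L (A :: D) B -> L (G ++ D) B;
  si_weakL : forall G A B, L G B -> L (A :: G) B;
  si_contrL : forall G A B, L (A :: A :: G) B -> L (A :: G) B;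
  si_weakR : forall G A, L G Bot -> L G A;
  si_andL1 : forall G A B C, L (A :: G) C -> L (And A B :: G) C;
  si_andL2 : forall G A B C, L (B :: G) C -> L (And A B :: G) C;
  si_andR : forall G A B, L G A -> L G B -> L G (And A B);
  si_orL : forall G A B C, L (A :: G) C -> L (B :: G) C -> L (Or A B :: G) C;
  si_orR1 : forall G A B, L G A -> L G (Or A B);
  si_orR2 : forall G A B, L G B -> L G (Or A B);
  si_impL : forall G D A B C,
    L G A -> L (B :: D) C -> L (Imp A B :: G ++ D) C;
  si_impR : forall G A B, L (A :: G) B -> L G (Imp A B);
  si_botL : forall A, L [Bot] A;
  si_allL : forall G X A T C, L (subst X T A :: G) C -> L (All X A :: G) C;
  si_allR : forall G X A,
    (forall B, In B G -> ~ free X B) -> L G A -> L G (All X A);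
  si_exR : forall G X A T, L G (subst X T A) -> L G (Ex X A);
  si_exL : forall G X A C,
    (forall B, In B G -> ~ free X B) -> ~ free X C ->
    L (A :: G) C -> L (Ex X A :: G) C
}.

(* Main.v *)
Require Import Defs.
From Stdlib Require Import List Permutation PeanoNat Lia.
Import ListNotations.

(** Write [d(P)] for [t(P) \/ ~ t(P)].  Under the assumption [P], the formula
    [P] is equivalent to [Top], so [d(P)] is equivalent to [d(Top)]; the
    quantifiers inside [t] do no harm, since equivalence is a congruence for
    them as well ([inst_congruence]).  Hence the instance of the hypothesis at
    [P] says that [~~P] and [P -> d(Top)] entail [P], where [d(Top)]
    does not depend on [P].

    Now let [P] be [d(Top)] itself.  Then [P -> d(Top)] is trivial, and [~~P]
    holds because [P] is an instance of the excluded middle.  So [d(Top)] is a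
    theorem, the premise [P -> d(Top)] is derivable for every [P], and what
    remains of the hypothesis is [~~P |- P].

    The congruence is proved for two simultaneous substitutions that are
    equivalent pointwise, by induction on the formula into which they are made.
    A binder is opened with a fresh variable [Y], which both substitutions send
    to itself, and closed again by binding [Y] ([bind_inst_scons]); so the
    induction hypothesis applies with the context unchanged, and the quantifier
    rules are only ever used with the witness [Y]. *)

(** * Renaming, instantiation and fresh variables *)

Lemma rename_ext (A : form) : forall r r' : nat -> nat,
  (forall n, free n A -> r n = r' n) -> rename r A = rename r' A.
Proof.
  induction A; simpl; intros r r' E; f_equal; auto.
  all: apply IHA; intros [|n] Hn; simpl; f_equal; auto.
Qed.

Lemma rename_rename (A : form) : forall r r' : nat -> nat,
  rename r (rename r' A) = rename (fun n => r (r' n)) A.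
Proof.
  induction A; simpl; intros r r'; f_equal; auto.
  all: rewrite IHA; apply rename_ext; intros [|n] _; reflexivity.
Qed.

Lemma inst_ext (A : form) : forall s s' : nat -> form,
  (forall n, free n A -> s n = s' n) -> inst s A = inst s' A.
Proof.
  induction A; simpl; intros s s' E; f_equal; auto.
  all: apply IHA; intros [|n] Hn; simpl; f_equal; auto.
Qed.

Lemma inst_Var (A : form) : inst Var A = A.
Proof.
  induction A; simpl; f_equal; auto.
  all: rewrite <- IHA at 2; apply inst_ext; intros [|n] _; reflexivity.
Qed.

Lemma rename_inst (A : form) : forall (r : nat -> nat) (s : nat -> form),
  rename r (inst s A) = inst (fun n => rename r (s n)) A.
Proof.
  induction A; simpl; intros r s; f_equal; auto.
  all: rewrite IHA; apply inst_ext; intros [|n] _; simpl; [reflexivity|].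
  all: rewrite !rename_rename; reflexivity.
Qed.

Lemma subst_self (Y : nat) (A : form) : subst Y (Var Y) A = A.
Proof.
  unfold subst. rewrite <- (inst_Var A) at 2. apply inst_ext. intros n _.
  destruct (Nat.eqb_spec n Y); congruence.
Qed.

Lemma free_bounded (A : form) : exists k, forall n, free n A -> n < k.
Proof.
  induction A; simpl.
  - exists (S n). intros; lia.
  - exists 0. tauto.
  - destruct IHA1 as [k1 H1], IHA2 as [k2 H2]. exists (k1 + k2).
    intros n [Hn|Hn]; [apply H1 in Hn|apply H2 in Hn]; lia.
  - destruct IHA1 as [k1 H1], IHA2 as [k2 H2]. exists (k1 + k2).
    intros n [Hn|Hn]; [apply H1 in Hn|apply H2 in Hn]; lia.
  - destruct IHA1 as [k1 H1], IHA2 as [k2 H2]. exists (k1 + k2).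
    intros n [Hn|Hn]; [apply H1 in Hn|apply H2 in Hn]; lia.
  - destruct IHA as [k H]. exists k. intros n Hn. apply H in Hn. lia.
  - destruct IHA as [k H]. exists k. intros n Hn. apply H in Hn. lia.
Qed.

Lemma fresh_variable (G : list form) :
  exists Y, forall B, In B G -> ~ free Y B.
Proof.
  enough (exists k, forall B n, In B G -> free n B -> n < k) as [k Hk].
  { exists k. intros B HB F. specialize (Hk B k HB F). lia. }
  induction G as [|A G [k Hk]].
  - exists 0. intros B n [].
  - destruct (free_bounded A) as [l Hl]. exists (k + l).
    intros B n [<-|HB] F; [apply Hl in F|apply (Hk B n HB) in F]; lia.
Qed.

(** Extends a substitution to the body of a binder that is opened with the
    variable [Y]: index 0 becomes [Y] and the values of [s] are not shifted. *)
Definition scons (Y : nat) (s : nat -> form) (n : nat) : form :=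
  match n with 0 => Var Y | S m => s m end.

(** What links the de Bruijn binders, under which [inst] works with [up s], to
    the rules of the calculus, which speak of named variables: going under the
    binder with [up s] is the same as opening it with a fresh name and binding
    that name afterwards. *)
Lemma bind_inst_scons (Y : nat) (s : nat -> form) (A : form) :
  (forall m, free (S m) A -> ~ free Y (s m)) ->
  bind Y (inst (scons Y s) A) = inst (up s) A.
Proof.
  intros HY. unfold bind. rewrite rename_inst. apply inst_ext.
  intros [|m] Hm; simpl.
  - now rewrite Nat.eqb_refl.
  - apply rename_ext. intros n Hn.
    destruct (Nat.eqb_spec n Y) as [->|]; [|reflexivity].
    now destruct (HY m Hm).
Qed.

(** * Derived rules of a super-intuitionistic logic *)

Section DerivedRules.
Context (L : list form -> form -> Prop) (hL : superintuitionistic L).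

Lemma absorb_hypothesis (G : list form) (A C : form) :
  In A G -> L (A :: G) C -> L G C.
Proof.
  intros HA H. destruct (in_split _ _ HA) as [G1 [G2 ->]].
  apply (si_exchange L hL (A :: G1 ++ G2)).
  { apply Permutation_middle. }
  apply (si_contrL L hL).
  apply (si_exchange L hL (A :: G1 ++ A :: G2)); [|exact H].
  apply perm_skip. symmetry. apply Permutation_middle.
Qed.

Lemma entails_incl (G D : list form) (C : form) :
  L G C -> incl G D -> L D C.
Proof.
  intros H Hincl.
  assert (HGD : L (G ++ D) C).
  { apply (si_exchange L hL (D ++ G)); [apply Permutation_app_comm|].
    clear Hincl. induction D; simpl; [exact H|now apply (si_weakL L hL)]. }
  clear H. induction G as [|A G IH]; [exact HGD|].
  apply IH.
  - intros B HB. apply Hincl. now right.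
  - apply (absorb_hypothesis _ A); [|exact HGD].
    apply in_or_app. right. apply Hincl. now left.
Qed.

Lemma entails_in (G : list form) (A : form) : In A G -> L G A.
Proof.
  intros HA. apply (entails_incl [A]); [apply (si_ax L hL)|].
  now intros B [<-|[]].
Qed.

(** The multiplicative rules for cut and implication duplicate the context;
    in the next three lemmas both premises share it. *)
Lemma cut_shared (G : list form) (A C : form) :
  L G A -> L (A :: G) C -> L G C.
Proof.
  intros HA HC. apply (entails_incl (G ++ G)).
  - exact (si_cut L hL _ _ _ _ HA HC).
  - apply incl_app; apply incl_refl.
Qed.

Lemma impL_shared (G : list form) (A B C : form) :
  L G A -> L (B :: G) C -> L (Imp A B :: G) C.
Proof.
  intros HA HC. apply (entails_incl (Imp A B :: G ++ G)).
  - now apply (si_impL L hL).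
  - intros F [<-|HF]; [now left|right].
    now destruct (in_app_or _ _ _ HF).
Qed.

Lemma modus_ponens (G : list form) (A B : form) :
  L G (Imp A B) -> L G A -> L G B.
Proof.
  intros HAB HA. apply (cut_shared _ _ _ HAB).
  apply impL_shared; [exact HA|]. apply entails_in. now left.
Qed.

Lemma not_not_excluded_middle (A : form) :
  L [] (Neg (Neg (Or A (Neg A)))).
Proof.
  apply (si_impR L hL).
  apply (modus_ponens _ (Or A (Neg A))); [apply entails_in; now left|].
  apply (si_orR2 L hL), (si_impR L hL).
  apply (modus_ponens _ (Or A (Neg A))).
  - apply entails_in. right. now left.
  - apply (si_orR1 L hL). apply entails_in. now left.
Qed.

(** * Equivalence is a congruence *)

Definition equivalent_under (G : list form) (A B : form) : Prop :=
  L (A :: G) B /\ L (B :: G) A.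

Lemma equivalent_under_refl (G : list form) (A : form) :
  equivalent_under G A A.
Proof. split; apply entails_in; now left. Qed.

Lemma equivalent_under_sym (G : list form) (A B : form) :
  equivalent_under G A B -> equivalent_under G B A.
Proof. intros [H1 H2]. now split. Qed.

Lemma scons_equivalent (G : list form) (Y : nat) (s s' : nat -> form)
    (A : form) :
  (forall n, free (S n) A -> equivalent_under G (s n) (s' n)) ->
  forall n, free n A -> equivalent_under G (scons Y s n) (scons Y s' n).
Proof.
  intros E [|n] Hn; simpl; [apply equivalent_under_refl|auto].
Qed.

(** Freshness for the values of [s] is asked only at the indices that occur in
    the body [A], which are finitely many: no variable need be fresh for all
    values of an arbitrary substitution. *)
Lemma fresh_for_opening (G : list form) (s s' : nat -> form) (A : form) :
  exists Y,
    (forall B, In B G -> ~ free Y B) /\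
    (forall m, free (S m) A -> ~ free Y (s m)) /\
    (forall m, free (S m) A -> ~ free Y (s' m)).
Proof.
  destruct (free_bounded A) as [k Hk].
  destruct (fresh_variable (G ++ map s (seq 0 k) ++ map s' (seq 0 k)))
    as [Y HY].
  exists Y. repeat split.
  - intros B HB. apply HY. apply in_or_app. now left.
  - intros m Hm. apply HY. apply in_or_app. right. apply in_or_app. left.
    apply in_map. apply in_seq. apply Hk in Hm. lia.
  - intros m Hm. apply HY. apply in_or_app. right. apply in_or_app. right.
    apply in_map. apply in_seq. apply Hk in Hm. lia.
Qed.

(** Only one direction is stated: as the hypothesis is symmetric, the induction
    hypothesis can be used with [s] and [s'] exchanged, which is what the
    antecedent of an implication requires. *)
Lemma inst_congruence (G : list form) (A : form) : forall s s' : nat -> form,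
  (forall n, free n A -> equivalent_under G (s n) (s' n)) ->
  L (inst s A :: G) (inst s' A).
Proof.
  induction A; simpl; intros s s' E.
  - now apply E.
  - apply entails_in. now left.
  - apply (si_andR L hL).
    + apply (si_andL1 L hL). auto.
    + apply (si_andL2 L hL). auto.
  - apply (si_orL L hL).
    + apply (si_orR1 L hL). auto.
    + apply (si_orR2 L hL). auto.
  - apply (si_impR L hL).
    apply (entails_incl (Imp (inst s A1) (inst s A2) :: inst s' A1 :: G)).
    + apply impL_shared.
      * apply IHA1. intros n Hn. apply equivalent_under_sym. auto.
      * apply (entails_incl (inst s A2 :: G)); [auto|].
        intros B [<-|HB]; [now left|right; now right].
    + intros B [<-|[<-|HB]]; simpl; auto.
  - destruct (fresh_for_opening (AllDB (inst (up s) A) :: G) s s' A)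
      as [Y [HG [Hs Hs']]].
    rewrite <- (bind_inst_scons Y s') by exact Hs'.
    apply (si_allR L hL _ Y); [exact HG|].
    rewrite <- (bind_inst_scons Y s) by exact Hs.
    apply (si_allL L hL _ Y _ (Var Y)). rewrite subst_self.
    apply IHA. now apply scons_equivalent.
  - destruct (fresh_for_opening (ExDB (inst (up s') A) :: G) s s' A)
      as [Y [HG [Hs Hs']]].
    rewrite <- (bind_inst_scons Y s) by exact Hs.
    apply (si_exL L hL _ Y).
    + intros B HB. apply HG. now right.
    + apply HG. now left.
    + rewrite <- (bind_inst_scons Y s') by exact Hs'.
      apply (si_exR L hL _ Y _ (Var Y)). rewrite subst_self.
      apply IHA. now apply scons_equivalent.
Qed.

Definition Top : form := Imp Bot Bot.

(** A formula that is assumed is equivalent to [Top], and the congruence turns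
    this into a passage from [A(Top)] to [A(P)]. *)
Lemma subst_Top_entails (X : nat) (P A : form) :
  L [subst X Top A; P] (subst X P A).
Proof.
  apply inst_congruence. intros n _.
  destruct (Nat.eqb_spec n X); [|apply equivalent_under_refl]. split.
  - apply entails_in. right. now left.
  - apply (si_impR L hL). apply entails_in. now left.
Qed.

End DerivedRules.

Theorem theorem5p10 (L : list form -> form -> Prop)
  (hL : superintuitionistic L)
  (X : nat) (t : form)
  (ht : forall Y : nat, free Y t -> Y = X)
  (h : forall P : form,
      L [Neg (Neg P); Imp P (Or (subst X P t) (Neg (subst X P t)))] P) :
  forall P : form, L [Neg (Neg P)] P.
Proof.
  set (c := Or (subst X Top t) (Neg (subst X Top t))).
  assert (guard : forall P,
      L [P; c] (Or (subst X P t) (Neg (subst X P t)))).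
  { intros P. apply (si_exchange L hL [c; P]); [apply perm_swap|].
    exact (subst_Top_entails L hL X P (Or t (Neg t))). }
  assert (hc : L [] c).
  { apply (cut_shared L hL _ (Imp c (Or (subst X c t) (Neg (subst X c t))))).
    - apply (si_impR L hL), (si_contrL L hL), guard.
    - apply (cut_shared L hL _ (Neg (Neg c))); [|apply h].
      apply (si_weakL L hL). apply (not_not_excluded_middle L hL). }
  intros P.
  apply (cut_shared L hL _ (Imp P (Or (subst X P t) (Neg (subst X P t))))).
  - apply (si_impR L hL). apply (cut_shared L hL _ c).
    + now apply (entails_incl L hL []).
    + apply (entails_incl L hL [P; c]); [apply guard|].
      intros B [<-|[<-|[]]]; simpl; auto.
  - apply (si_exchange L hL [Neg (Neg P);
      Imp P (Or (subst X P t) (Neg (subst X P t)))]); [apply perm_swap|apply h].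
Qed.
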